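(* Let $k$ be odd. Then $$\mathrm{Aut}_{\mathfrak{s}_k}=\{\xi A_\eta:\ \xi,\eta\in U_k\},$$ which is isomorphic to the group $\mathbb{Z}_k\times\mathbb{Z}_k$.
   Context: For a positive integer $k$, the polynomials $p_0^k$ and $p_1^{k-1}$ in two variables are determined by $(x+\imath y)^k=p_0^k(x,y^2)+\imath\, y\,p_1^{k-1}(x,y^2)$ for $x,y\in\mathbb{R}$. Let $\mathcal{S}=\{(s_1,s_2,s_3)\in\mathbb{C}^3: s_1^2+s_2^2+s_3^2=1\}$, $$W=\{((u_0,u_1),s)\in\mathbb{C}^2\times\mathcal{S}:\ u_0\neq0,\ u_1\neq0,\ u_0^2+u_1^2\neq0\},$$ $$W_k=\{((u_0,u_1),s)\in W:\ p_1^{k-1}(u_0,u_1^2)\neq0\},$$ and let $\mathfrak{s}_k$ be given by $$\mathfrak{s}_k((u_0,u_1),s)=\big((p_0^k(u_0,u_1^2),\ u_1p_1^{k-1}(u_0,u_1^2)),\ s\big),$$ considered as a covering map $\mathfrak{s}_k:W_k\to W$ of degree $k^2$. For a covering map $\pi:X\to Y$, $\mathrm{Aut}_\pi$ denotes the group of automorphisms $f$ of $X$ such that $\pi\circ f=\pi$. $U_k$ is the group of complex $k$-th roots of unity, and for $\eta\in\mathbb{C}$ $$A_\eta=\begin{pmatrix}\mathrm{Re}\,\eta&-\mathrm{Im}\,\eta\\ \mathrm{Im}\,\eta&\mathrm{Re}\,\eta\end{pmatrix}.$$ A complex $2\times2$ matrix $M$ is identified with the map $(u,s)\mapsto(Mu,s)$,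 $u\in\mathbb{C}^2$, $s\in\mathcal{S}$, so $\xi A_\eta$ denotes $(u,s)\mapsto(\xi A_\eta u,s)$.
   Formalization: The domain of s_k is taken to be the points of W_k that s_k maps into W (i.e. p_0^k(u_0,u_1^2)≠0 is added), since for odd k≥3 s_k does not map all of W_k into W (e.g. k=3, u_0^2=3u_1^2). *)

(* Defs.v *)
From HB Require Import structures.
From mathcomp Require Import all_boot all_order all_algebra all_fingroup.
From mathcomp Require Import polyXY complex.
From mathcomp Require Import all_classical all_reals all_analysis.
From mathcomp Require Import ring.

Set Implicit Arguments.
Unset Strict Implicit.
Unset Printing Implicit Defensive.

Import Order.TTheory GRing.Theory Num.Theory.
Import numFieldNormedType.Exports.

Local Open Scope classical_set_scope.
Local Open Scope ring_scope.

Definition homeomorphism (X Y : topologicalType) (f : X -> Y) : Prop :=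
  exists g : Y -> X,
    [/\ cancel f g, cancel g f, continuous f & continuous g].

Section DeckGroup.
Context {X Y : topologicalType}.
Implicit Types (p : X -> Y) (f g : X -> X).

Definition is_deck p : set (X -> X) :=
  [set f | homeomorphism f /\ p \o f = p].

Definition Deck p : Type := {f : X -> X | is_deck p f}.

Definition deck_fun p (a : Deck p) : X -> X := sval a.

Lemma is_deck_id p : is_deck p id.
Proof. by split=> //; exists id; split=> // x; exact: cvg_id. Qed.

Lemma is_deck_comp p f g : is_deck p f -> is_deck p g -> is_deck p (f \o g).
Proof.
move=> [[f' [fK f'K cf cf']] pf] [[g' [gK g'K cg cg']] pg]; split.
  exists (g' \o f'); split; first exact: can_comp.
  - exact: can_comp.
  - by move=> x; apply: continuous_comp; [exact: cg|exact: cf].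
  - by move=> x; apply: continuous_comp; [exact: cf'|exact: cg'].
by rewrite compA pf pg.
Qed.

Lemma is_deck_inv p f : is_deck p f -> exists g, is_deck p g /\ cancel f g.
Proof.
move=> [[g [fK gK cf cg]] pf]; exists g; split => //; split; first by exists f.
by apply/funext => x /=; rewrite -[in LHS]pf /= gK.
Qed.

Definition deck_one p : Deck p := exist _ _ (is_deck_id p).

Definition deck_mul p (a b : Deck p) : Deck p :=
  exist _ _ (is_deck_comp (svalP a) (svalP b)).

Definition deck_inv p (a : Deck p) : Deck p :=
  let e := cid (is_deck_inv (svalP a)) in exist _ (sval e) (svalP e).1.

Lemma deck_fun_inj p : injective (@deck_fun p).
Proof. by move=> [f pf] [g pg] /= fg; exact: eq_exist. Qed.

Lemma deck_mulA p : associative (@deck_mul p).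
Proof. by move=> a b c; exact: deck_fun_inj. Qed.

Lemma deck_mul1 p : left_id (deck_one p) (@deck_mul p).
Proof. by move=> a; exact: deck_fun_inj. Qed.

Lemma deck_1mul p : right_id (deck_one p) (@deck_mul p).
Proof. by move=> a; exact: deck_fun_inj. Qed.

Lemma deck_mulV p : left_inverse (deck_one p) (@deck_inv p) (@deck_mul p).
Proof.
move=> a; apply: deck_fun_inj; apply/funext => x /=; rewrite /deck_inv /=.
by case: cid => g [/= _ ->].
Qed.

Lemma deck_Vmul p : right_inverse (deck_one p) (@deck_inv p) (@deck_mul p).
Proof.
move=> a; have := deck_mulV (deck_inv a); set b := deck_inv a => bV.
by rewrite -[LHS]deck_mul1 -{1}bV -deck_mulA (deck_mulA b) deck_mulV deck_mul1.
Qed.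

HB.instance Definition _ p := gen_eqMixin (Deck p).
HB.instance Definition _ p := gen_choiceMixin (Deck p).
HB.instance Definition _ p := isGroup.Build (Deck p)
  (@deck_mulA p) (@deck_mul1 p) (@deck_1mul p) (@deck_mulV p) (@deck_Vmul p).
End DeckGroup.

Definition isomorphic (G H : groupType) : Prop :=
  exists f : G -> H, bijective f /\ {morph f : x y / (x * y)%g}.

(* Z/k for k > 0, written additively in ring_scope and multiplicatively in
   group_scope. 'Z_k is not used because it has two elements when k = 1. *)
Definition Zmod (k : nat) : finGroupType := 'I_k.-1.+1.

(* The name makes the norm topology available, which the analysis library
   attaches to numClosedFieldType but not to the type R[i] itself. *)
Definition Cplx (R : realType) : numClosedFieldType := R[i].

Section Covering.
Variable R : realType.
Local Notation C := (Cplx R).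

Definition real_cplx : {rmorphism R -> C} := real_complex R.

(* For p : {poly {poly R}}, p.[x, y] substitutes x for the outer variable and
   y for the inner one. *)
Definition is_p01 (k : nat) (p0 p1 : {poly {poly R}}) : Prop :=
  forall x y : R,
    (real_cplx x + 'i * real_cplx y) ^+ k =
    real_cplx p0.[x, y ^+ 2] + 'i * real_cplx y * real_cplx p1.[x, y ^+ 2].

Lemma is_p01_exists (k : nat) : exists p0 p1, is_p01 k p0 p1.
Proof.
elim: k => [|k [p0 [p1 IH]]].
  by exists 1, 0 => x y; rewrite expr0 !hornerE rmorph1.
exists ('X * p0 - 'X%:P * p1), ('X * p1 + p0) => x y.
rewrite exprS IH !hornerE !(rmorphB, rmorphD, rmorphM, rmorphXn) /=.
have i2 : 'i * 'i = -1 :> C by rewrite -expr2 sqrCi.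
set a := real_cplx x; set b := real_cplx y.
have -> : b * b = - ('i * 'i) * b * b by rewrite i2 opprK mul1r.
by ring.
Qed.

Definition eval2 (p : {poly {poly R}}) (a b : C) : C :=
  (map_poly (map_poly real_cplx) p).[a, b].

Definition ambient : topologicalType := ('cV[C]_2 * 'cV[C]_3)%type.

Definition csphere : set 'cV[C]_3 := [set s | \sum_(i < 3) s i 0 ^+ 2 = 1].

Definition W : set ambient :=
  [set x : ambient | let u0 := x.1 0 0 in let u1 := x.1 1 0 in
    [/\ csphere x.2, u0 != 0, u1 != 0 & u0 ^+ 2 + u1 ^+ 2 != 0]].

Definition Wk (p1 : {poly {poly R}}) : set ambient :=
  [set x : ambient | W x /\ eval2 p1 (x.1 0 0) (x.1 1 0 ^+ 2) != 0].

Definition sk (p0 p1 : {poly {poly R}}) (x : ambient) : ambient :=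
  let u0 := x.1 0 0 in let u1 := x.1 1 0 in
  (\col_(i < 2) (if i == 0 then eval2 p0 u0 (u1 ^+ 2)
                 else u1 * eval2 p1 u0 (u1 ^+ 2)),
   x.2).

(* The points of Wk mapped into W. The condition sk x \in W is automatic only
   for k = 1: for instance, if k = 3, u0 ^+ 2 = 3 * u1 ^+ 2 and u1 != 0 then
   (u0, u1) satisfies the conditions defining Wk, while sk x has first
   coordinate 0 and so lies outside W. *)
Definition dom_sk (p0 p1 : {poly {poly R}}) : set ambient :=
  Wk p1 `&` sk p0 p1 @^-1` W.

Lemma sk_cov_subproof (p0 p1 : {poly {poly R}})
  (x : set_type (dom_sk p0 p1)) : sk p0 p1 (set_val x) \in W.
Proof. by apply/mem_set; have [] := set_mem (valP x). Qed.

Definition sk_cov (p0 p1 : {poly {poly R}})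
    (x : set_type (dom_sk p0 p1)) : set_type W :=
  exist _ (sk p0 p1 (set_val x)) (sk_cov_subproof x).

Definition unity_roots (k : nat) : set C := [set z | z ^+ k = 1].

Definition rot_mx (eta : C) : 'M[C]_2 :=
  \matrix_(i < 2, j < 2)
    if i == j then 'Re eta
    else if i == 0 then - 'Im eta else 'Im eta.

Definition mx_act (M : 'M[C]_2) (x : ambient) : ambient := (M *m x.1, x.2).
End Covering.

Arguments W R : clear implicits.
Arguments sk_cov {R} p0 p1 x.
Arguments unity_roots R k : clear implicits.

(* Main.v *)
Require Import Defs.
From mathcomp Require Import all_boot all_order all_algebra all_fingroup.
From mathcomp Require Import all_solvable all_field.
From mathcomp Require Import polyXY complex.
From mathcomp Require Import all_classical all_reals all_analysis.
From mathcomp Require Import ring.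

(** In the isotropic coordinates [w = u0 + 'i * u1] and [z = u0 - 'i * u1] the
    map [sk] is [(w, z, s) |-> (w ^+ k, z ^+ k, s)]: the defining relation of
    [p0] and [p1], known for real arguments, is an identity of polynomials, so
    it also holds for complex ones, and replacing [u1] by [- u1] gives the
    second coordinate ([wcoord_sk], [zcoord_sk]).  For odd [k] the domain is cut
    out of [C^2] times the complex sphere by the single inequation
    [w * z * (w ^+ k + z ^+ k) * (w ^+ k - z ^+ k) != 0] ([dom_skP]).

    A deck transformation [f] therefore multiplies [w] and [z] by [k]-th roots
    of unity that depend continuously on the point.  The domain being connected,
    these two roots are constant, and [f] is the linear map [scale_mx a b],
    diagonal in the coordinates [w, z] ([deck_is_scale]); conversely all these
    maps are deck transformations ([scale_is_deck]).  As the conjugate of a root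
    of unity is its inverse, [A_eta] scales [w] by [eta] and [z] by [eta^-1], so
    that [xi *: A_eta] is [scale_mx (xi * eta) (xi / eta)].  For odd [k] squaring
    is a bijection of the group of [k]-th roots of unity, hence every pair
    [(a, b)] has this form ([odd_unity_factor]).  The group is thus the square
    of the cyclic group of [k]-th roots of unity.

    Connectedness is obtained from rational curves.  If a curve
    [gam : C -> T] stays in a set [A] wherever a polynomial [P] with
    [P(0) != 0] and [P(1) != 0] does not vanish, then [gam 0] and [gam 1] are
    linked by a path in [A], because [P] has finitely many roots and some
    parabolic arc from 0 to 1 in the complex plane misses all of them
    ([linked_rational]).  Straight lines link points with the same [s], and on
    the sphere two points [s], [t] with [s . t != -1] are linked by the rational
    parametrization of a conic ([linked_plane], [linked_sphere]). *)

Set Implicit Arguments.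
Unset Strict Implicit.
Unset Printing Implicit Defensive.

Import Order.TTheory GRing.Theory Num.Theory.
Import numFieldNormedType.Exports.

Local Open Scope classical_set_scope.
Local Open Scope ring_scope.

(** * The defining identity over the complex numbers *)

Section Identity.
Variable R : realType.
Local Notation C := (Cplx R).
Local Notation rc := (real_cplx R).

(** The points [(x, y ^+ 2)] contain a grid of arbitrary size, which is enough
    to separate bivariate polynomials. *)
Lemma bipoly_eq_on_squares (p q : {poly {poly R}}) :
  (forall x y : R, y != 0 -> p.[x, y ^+ 2] = q.[x, y ^+ 2]) -> p = q.
Proof.
move=> pq; apply/eqP; rewrite -subr_eq0; apply/eqP.
set d := p - q.
have d0 x y : y != 0 -> d.[x, y ^+ 2] = 0.
  by move=> y0; rewrite /d !hornerE pq // subrr.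
have inj_nat : injective (fun n : nat => n%:R : R).
  by move=> m n /eqP; rewrite eqr_nat => /eqP.
have dx x : d.[x%:P] = 0.
  pose rs := [seq n.+1%:R ^+ 2 : R | n <- iota 0 (size d.[x%:P])].
  apply: (@roots_geq_poly_eq0 _ _ rs); last by rewrite size_map size_iota.
    apply/allP => _ /mapP[n _ ->].
    by rewrite /root (d0 x n.+1%:R) ?pnatr_eq0.
  rewrite map_inj_uniq ?iota_uniq // => m n /eqP.
  rewrite -subr_eq0 subr_sqr mulf_eq0 -natrD pnatr_eq0 /= orbF subr_eq0.
  by rewrite eqr_nat eqSS => /eqP.
pose rs := [seq (n%:R)%:P : {poly R} | n <- iota 0 (size d)].
apply: (@roots_geq_poly_eq0 _ _ rs); last by rewrite size_map size_iota.
  by apply/allP => _ /mapP[n _ ->]; rewrite /root dx.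
by rewrite map_inj_uniq ?iota_uniq // => m n /polyC_inj/inj_nat.
Qed.

Lemma real_cplx_real (x : R) : rc x \is Num.real.
Proof. by apply/complex_realP; exists x. Qed.

Lemma real_cplx_rect_inj (a b c d : R) :
  rc a + 'i * rc b = rc c + 'i * rc d ->
  a = c /\ b = d.
Proof.
move=> e; split; apply: (fmorph_inj (real_cplx R)).
  by move: (congr1 (@Re _) e); rewrite !Re_rect ?real_cplx_real.
by move: (congr1 (@Im _) e); rewrite !Im_rect ?real_cplx_real.
Qed.

(** Real and imaginary parts determine the values of [p0] at all
    [(x, y ^+ 2)], and those of [p1] at the ones with [y != 0]. *)
Lemma is_p01_unique k (p0 p1 q0 q1 : {poly {poly R}}) :
  is_p01 k p0 p1 -> is_p01 k q0 q1 -> p0 = q0 /\ p1 = q1.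
Proof.
move=> hp hq.
have e x y : p0.[x, y ^+ 2] = q0.[x, y ^+ 2] /\
    y * p1.[x, y ^+ 2] = y * q1.[x, y ^+ 2].
  apply: real_cplx_rect_inj; rewrite !rmorphM !mulrA.
  by rewrite -hp -hq.
split; apply: bipoly_eq_on_squares => x y y0; first by case: (e x y).
by case: (e x y) => _ /(mulfI y0).
Qed.

Lemma eval2D (p q : {poly {poly R}}) a b :
  eval2 (p + q) a b = eval2 p a b + eval2 q a b.
Proof. by rewrite /eval2 rmorphD /= !hornerD. Qed.

Lemma eval2M (p q : {poly {poly R}}) a b :
  eval2 (p * q) a b = eval2 p a b * eval2 q a b.
Proof. by rewrite /eval2 rmorphM /= !hornerM. Qed.

(** The recursion coming from multiplication by [a + 'i * b] only uses that
    ['i] is a square root of [-1], so it works over [C] as it does over [R]. *)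
Lemma eval2_complex_exists k : exists p0 p1 : {poly {poly R}}, forall a b : C,
  (a + 'i * b) ^+ k = eval2 p0 a (b ^+ 2) + 'i * b * eval2 p1 a (b ^+ 2).
Proof.
elim: k => [|k [p0 [p1 IH]]].
  exists (1%:P)%:P, 0 => a b; rewrite expr0 /eval2 map_poly0 !map_polyC !hornerC.
  by rewrite mulr0 addr0 /= map_polyC hornerC -[LHS](rmorph1 rc).
exists ('X * p0 + (-1)%:P * ('X%:P * p1)), ('X * p1 + p0) => a b.
have eX (c d : C) : eval2 'X c d = c by rewrite /eval2 map_polyX hornerX hornerC.
have eY (c d : C) : eval2 'X%:P c d = d.
  by rewrite /eval2 map_polyC /= map_polyX hornerC hornerX.
have eN (c d : C) : eval2 (-1)%:P c d = -1.
  by rewrite /eval2 map_polyC /= rmorphN1 hornerC hornerN hornerC.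
rewrite exprS IH !(eval2D, eval2M, eX, eY, eN) expr2.
have i2 : 'i * 'i = -1 :> C by rewrite -expr2 sqrCi.
rewrite -i2; ring.
Qed.

Lemma eval2_real (p : {poly {poly R}}) (x y : R) :
  eval2 p (rc x) (rc y) = rc p.[x, y].
Proof.
by rewrite /eval2 -map_polyC horner_map horner_map.
Qed.

(** Uniqueness of [p0] and [p1] transfers the complex identity from the
    polynomials built by recursion to the given ones. *)
Lemma is_p01_complex k (p0 p1 : {poly {poly R}}) : is_p01 k p0 p1 ->
  forall a b : C,
  (a + 'i * b) ^+ k = eval2 p0 a (b ^+ 2) + 'i * b * eval2 p1 a (b ^+ 2).
Proof.
move=> hp; have [q0 [q1 hq]] := eval2_complex_exists k.
suff /(is_p01_unique hp)[-> ->] : is_p01 k q0 q1 by [].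
by move=> x y; rewrite hq -!rmorphXn !eval2_real.
Qed.

End Identity.

(** * Roots of unity *)

Section RootsOfUnity.
Variable R : realType.
Local Notation C := (Cplx R).

Lemma prim_root_exists k : (0 < k)%N -> exists z : C, k.-primitive_root z.
Proof.
move=> k0; have [rs] := closed_field_poly_normal ('X^k - 1 : {poly C}).
rewrite (monicP _) ?monicXnsubC // scale1r => e.
have rs1 : all k.-unity_root rs.
  by apply/allP => z; rewrite -root_prod_XsubC -e.
have szr : (k < (size rs).+1)%N.
  by rewrite -(size_prod_XsubC rs id) -e size_XnsubC.
have [|z _ hz] := hasP (has_prim_root k0 rs1 _ szr); last by exists z.
by rewrite -separable_prod_XsubC -e separable_Xn_sub_1 // pnatr_eq0 -lt0n.
Qed.

Lemma unity_neq0 k (c : C) : (0 < k)%N -> c ^+ k = 1 -> c != 0.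
Proof.
by move=> k0; apply: contra_eq_neq => ->; rewrite expr0n gtn_eqF // eq_sym oner_neq0.
Qed.

Lemma unity_conj k (eta : C) : (0 < k)%N -> eta ^+ k = 1 -> eta^* = eta^-1.
Proof.
move=> k0 ek.
have n1 : `|eta| = 1.
  apply/eqP; rewrite -(@pexpr_eq1 _ _ k) //.
  by rewrite -normrX ek normr1.
by rewrite invC_norm n1 expr1n invr1 mul1r.
Qed.

(** For odd [k], the power of exponent [k./2.+1] is a square root on the
    [k]-th roots of unity; [xi] and [eta] are the square roots of [a * b] and
    of [a / b]. *)
Lemma odd_unity_factor k (a b : C) : odd k -> a ^+ k = 1 -> b ^+ k = 1 ->
  exists xi eta : C,
    [/\ xi ^+ k = 1, eta ^+ k = 1, xi * eta = a & xi * eta^-1 = b].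
Proof.
move=> hk ak bk.
have k0 : (0 < k)%N by case: (k) hk.
have a0 := unity_neq0 k0 ak; have b0 := unity_neq0 k0 bk.
pose m := (k./2).+1.
have sq (c : C) : c ^+ k = 1 -> c ^+ m * c ^+ m = c.
  move=> ck; rewrite -exprD addnn /m doubleS.
  have -> : (k./2.*2).+2 = k.+1 by rewrite -[in RHS](odd_double_half k) hk.
  by rewrite exprS ck mulr1.
exists ((a * b) ^+ m), ((a / b) ^+ m); split.
- by rewrite -exprM mulnC exprM exprMn ak bk mulr1 expr1n.
- by rewrite -exprM mulnC exprM expr_div_n ak bk divr1 expr1n.
- rewrite -exprMn (_ : a * b * (a / b) = a * a); last by field.
  by rewrite exprMn sq.
- rewrite -exprVn -exprMn (_ : a * b * (a / b)^-1 = b * b); last first.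
    by field; rewrite a0 b0.
  by rewrite exprMn sq.
Qed.

End RootsOfUnity.

(** * Paths along rational curves *)

Lemma horner_continuous (K : numFieldType) (p : {poly K}) :
  continuous (horner p : K -> K).
Proof.
elim/poly_ind: p => [|p c IH] x.
  rewrite (_ : horner 0 = fun=> 0); last by apply/funext => y; rewrite horner0.
  exact: (@cvg_cst K 0 K (nbhs x) (nbhs_filter x)).
rewrite (_ : horner _ = fun y => p.[y] * y + c); last first.
  by apply/funext => y; rewrite hornerMXaddC.
have h := @cvgM K K (nbhs x) (nbhs_filter x) _ _ _ _ (IH x) cvg_id.
exact: (@cvgD K K K (nbhs x) (nbhs_filter x) _ _ _ _ h (cvg_cst c)).
Qed.

Section Paths.
Variable R : realType.
Local Notation C := (Cplx R).
Local Notation rc := (real_cplx R).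

Lemma rc_continuous : continuous (rc : R -> C).
Proof.
move=> x; apply/cvgrPdist_lt => e e0.
have [e' ee] : exists e', e = rc e'.
  by move: (gtr0_real e0) => /complex_realP[k ->]; exists k.
have e'0 : 0 < e' by move: e0; rewrite ee ltcR.
near=> y.
rewrite -rmorphB /= ee.
have -> : `|rc (x - y)| = rc `|x - y|.
  by rewrite normc_def /= expr0n addr0 sqrtr_sqr.
rewrite ltcR; near: y.
by apply/nbhs_ballP; exists e'.
Unshelve. all: by end_near. Qed.

(** A fibre of a continuous map into the finite set of [k]-th roots of unity is
    both open and closed. *)
Lemma unity_const_on_path (X : topologicalType) (g : X -> C) k : (0 < k)%N ->
  continuous g -> (forall x, g x ^+ k = 1) ->
  forall h : R -> X, continuous h -> forall r s, g (h r) = g (h s).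
Proof.
move=> k0 cg gk h ch r s.
have cgh : continuous (g \o h).
  by move=> t; apply: continuous_comp; [exact: ch | exact: cg].
have fin : finite_set [set z : C | z ^+ k = 1 /\ z != g (h r)].
  have [rs] := closed_field_poly_normal ('X^k - 1 : {poly C}).
  rewrite (monicP _) ?monicXnsubC // scale1r => e.
  apply: (@sub_finite_set _ _ [set` rs]); last exact: finite_seq.
  move=> z [zk _] /=; rewrite -root_prod_XsubC -e rootE !hornerE.
  by rewrite zk subrr.
have closed_fin (A : set C) : finite_set A -> closed A.
  by move: A; apply/accessible_finite_set_closed/hausdorff_accessible/norm_hausdorff.
have cl1 : closed [set g (h r)] by apply: closed_fin; exact: finite_set1.
have clo := closed_fin _ fin.
have conn : connected [set: R] by apply/connected_intervalP.
suff : ((g \o h) @^-1` [set g (h r)]) s by [].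
rewrite (_ : _ @^-1` _ = setT) //.
apply: conn; first by exists r.
- exists (~` ((g \o h) @^-1` [set z : C | z ^+ k = 1 /\ z != g (h r)])).
    by rewrite openC; apply: closed_comp clo => ? _; exact: cgh.
  rewrite setTI; apply/seteqP; split => x /=; first by move=> -> [_ /eqP].
  by move=> nx; apply: contrapT => xr; apply: nx; split; [exact: gk|apply/eqP].
- exists ((g \o h) @^-1` [set g (h r)]); last by rewrite setTI.
  by apply: closed_comp cl1 => ? _; exact: cgh.
Qed.

(** Distinct members of the family of arcs [r + 'i * c * r * (1 - r)], with [c]
    real, only meet over [r = 0] and [r = 1]; hence each root of [P] lies on at
    most one of them. *)
Lemma avoid_roots_path (P : {poly C}) : P.[0] != 0 -> P.[1] != 0 ->
  exists t : R -> C, [/\ continuous t, t 0 = 0, t 1 = 1 &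
    forall r, P.[t r] != 0].
Proof.
move=> P0 P1.
have [rs eP] := closed_field_poly_normal P.
have Pn0 : P != 0 by apply: contraNneq P0 => ->; rewrite horner0.
(* The only parameter whose arc can pass through [z]. *)
pose bad (z : C) : R := complex.Im z / (complex.Re z * (1 - complex.Re z)).
pose c := 1 + \sum_(z <- rs) `|bad z|.
have cbad z : z \in rs -> c != bad z.
  move=> zrs; suff : bad z < c by move=> /lt_eqF; rewrite eq_sym => ->.
  apply: le_lt_trans (ler_norm _) _.
  rewrite /c (big_rem z) //= addrCA ltrDl.
  by rewrite ltr_wpDr // sumr_ge0.
pose t (r : R) : C := rc r + 'i * (rc c * (rc r * (1 - rc r))).
exists t; split.
- move=> r; apply: cvgD; first exact: rc_continuous.
  apply: cvgM; first exact: cvg_cst.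
  apply: cvgM; first exact: cvg_cst.
  apply: cvgM; first exact: rc_continuous.
  exact: (@cvgB _ C _ _ _ (fun=> 1) rc _ _ (cvg_cst _) (@rc_continuous r)).
- by rewrite /t rmorph0 mul0r !mulr0 addr0.
- by rewrite /t rmorph1 subrr !mulr0 addr0.
move=> r; apply/negP => rt.
have trs : t r \in rs.
  by move: rt; rewrite -rootE eP rootZ ?lead_coef_eq0 // root_prod_XsubC.
have et : t r = rc r + 'i * rc (c * (r * (1 - r))).
  by rewrite /t !rmorphM rmorphB rmorph1.
have Ere : complex.Re (t r) = r.
  apply: (fmorph_inj rc); apply: etrans (complexRe (t r)) _; rewrite et.
  by rewrite (Re_rect (real_cplx_real _) (real_cplx_real _)).
have Eim : complex.Im (t r) = c * (r * (1 - r)).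
  apply: (fmorph_inj rc); apply: etrans (complexIm (t r)) _; rewrite et.
  by rewrite (Im_rect (real_cplx_real _) (real_cplx_real _)).
have [r0|rn0] := eqVneq (r * (1 - r)) 0.
  move/eqP: r0; rewrite mulf_eq0 subr_eq0 => /orP[] /eqP r0; move: rt.
    by rewrite r0 /t rmorph0 mul0r !mulr0 addr0 (negbTE P0).
  by rewrite -r0 /t rmorph1 subrr !mulr0 addr0 (negbTE P1).
by move: (cbad _ trs); rewrite /bad Ere Eim mulfK // eqxx.
Qed.

(** Paths are parametrized by all of [R], so that they are plain continuous maps
    on a connected space. *)
Definition linked (T : topologicalType) (A : set T) (x y : T) :=
  exists h : R -> set_type A,
    [/\ continuous h, set_val (h 0) = x & set_val (h 1) = y].

Lemma linked_const (T : topologicalType) (A : set T) (g : set_type A -> C) k :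
  (0 < k)%N -> continuous g -> (forall x, g x ^+ k = 1) ->
  forall x y : set_type A, linked A (set_val x) (set_val y) -> g x = g y.
Proof.
move=> k0 cg gk x y [h [ch h0 h1]].
have <- : h 0 = x by apply: val_inj.
have <- : h 1 = y by apply: val_inj.
exact: unity_const_on_path gk _ ch _ _.
Qed.

(** In the applications, the roots of [P] are the parameters at which a rational
    curve has a pole or leaves [A]. *)
Lemma linked_rational (T : topologicalType) (A : set T) (gam : C -> T)
    (P : {poly C}) :
  P.[0] != 0 -> P.[1] != 0 ->
  (forall t, P.[t] != 0 -> A (gam t) /\ {for t, continuous gam}) ->
  linked A (gam 0) (gam 1).
Proof.
move=> P0 P1 PA; have [t [ct t0 t1 Pt]] := avoid_roots_path P0 P1.
exists (fun r => exist _ (gam (t r)) (mem_set (PA _ (Pt r)).1)).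
rewrite !set_valE /= t0 t1; split => //.
apply: continuous_comp_initial => r; rewrite set_valE /=.
apply: (@continuous_comp _ _ _ t gam); first exact: ct.
exact: (PA _ (Pt r)).2.
Qed.

Lemma scale_continuous m (X : topologicalType) (f : X -> C)
    (u : 'cV[C]_m.+1) (x : X) :
  {for x, continuous f} -> {for x, continuous (fun y => f y *: u)}.
Proof.
move=> cf.
exact: (@cvgZr_tmp C 'cV[C]_m.+1 X (nbhs x) (nbhs_filter x) f _ u cf).
Qed.

Lemma linear_comb_continuous m (X : topologicalType) (f g : X -> C)
    (u v : 'cV[C]_m.+1) (x : X) :
  {for x, continuous f} -> {for x, continuous g} ->
  {for x, continuous (fun y => f y *: u + g y *: v)}.
Proof.
move=> cf cg.
have h1 : (fun y => f y *: u) @ x --> f x *: u := scale_continuous (u := u) cf.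
have h2 : (fun y => g y *: v) @ x --> g x *: v := scale_continuous (u := v) cg.
exact: (@cvgD C 'cV[C]_m.+1 X (nbhs x) (nbhs_filter x) _ _ _ _ h1 h2).
Qed.

End Paths.

(** * Isotropic coordinates and the domain of the covering *)

Section Isotropic.
Variable R : realType.
Local Notation C := (Cplx R).

Definition wcoord (u : 'cV[C]_2) : C := u 0 0 + 'i * u 1 0.
Definition zcoord (u : 'cV[C]_2) : C := u 0 0 - 'i * u 1 0.

Lemma two_neq0 : 2 != 0 :> C. Proof. by rewrite pnatr_eq0. Qed.
Lemma i_neq0 : 'i != 0 :> C. Proof. exact: neq0Ci. Qed.
Lemma mulii : 'i * 'i = -1 :> C. Proof. by rewrite -expr2 sqrCi. Qed.

Lemma u0_wz (u : 'cV[C]_2) : 2 * u 0 0 = wcoord u + zcoord u.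
Proof. by rewrite /wcoord /zcoord; ring. Qed.

Lemma u1_wz (u : 'cV[C]_2) : 2 * 'i * u 1 0 = wcoord u - zcoord u.
Proof. by rewrite /wcoord /zcoord; ring. Qed.

Lemma wz_inj u v : wcoord u = wcoord v -> zcoord u = zcoord v -> u = v.
Proof.
move=> ew ez; apply/matrixP => i j; rewrite ord1.
have [->|->] : i = 0 \/ i = 1.
  by case: i => [[|[|//]] ilt]; [left|right]; apply: val_inj.
- by apply: (mulfI two_neq0); rewrite !u0_wz ew ez.
- by apply: (mulfI (mulf_neq0 two_neq0 i_neq0)); rewrite !u1_wz ew ez.
Qed.

Lemma wcoordD u v : wcoord (u + v) = wcoord u + wcoord v.
Proof. by rewrite /wcoord !mxE; ring. Qed.
Lemma zcoordD u v : zcoord (u + v) = zcoord u + zcoord v.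
Proof. by rewrite /zcoord !mxE; ring. Qed.

Lemma wcoordZ a u : wcoord (a *: u) = a * wcoord u.
Proof. by rewrite /wcoord !mxE; ring. Qed.
Lemma zcoordZ a u : zcoord (a *: u) = a * zcoord u.
Proof. by rewrite /zcoord !mxE; ring. Qed.

Lemma wcoord_continuous : continuous wcoord.
Proof.
move=> u; have c i := @coord_continuous C 2 1 i 0 u.
exact: (cvgD (c 0) (cvgM (cvg_cst _) (c 1))).
Qed.

Lemma zcoord_continuous : continuous zcoord.
Proof.
move=> u; have c i := @coord_continuous C 2 1 i 0 u.
exact: (cvgB (c 0) (cvgM (cvg_cst _) (c 1))).
Qed.

Lemma wcoord_sk k p0 p1 (hp : is_p01 k p0 p1) (x : ambient R) :
  wcoord (sk p0 p1 x).1 = wcoord x.1 ^+ k.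
Proof. by rewrite /wcoord /sk !mxE /= (is_p01_complex hp) mulrA. Qed.

(** The identity defining [p0] and [p1] at [(u0, - u1)]: only the square of the
    second argument enters [p0] and [p1]. *)
Lemma zcoord_sk k p0 p1 (hp : is_p01 k p0 p1) (x : ambient R) :
  zcoord (sk p0 p1 x).1 = zcoord x.1 ^+ k.
Proof.
rewrite /zcoord /sk !mxE /=.
have := is_p01_complex hp (x.1 0 0) (- x.1 1 0).
by rewrite sqrrN mulrN => ->; ring.
Qed.

(** When [w] and [z] are the isotropic coordinates of [u], the last two factors
    are, up to constants, the components [p0(u0, u1^2)] and [u1 * p1(u0, u1^2)]
    of [sk]. *)
Definition disc k (w z : C) : C := w * z * (w ^+ k + z ^+ k) * (w ^+ k - z ^+ k).

Lemma W_wz (x : ambient R) : W R x <-> csphere x.2 /\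
  disc 1 (wcoord x.1) (zcoord x.1) != 0.
Proof.
have e : wcoord x.1 * zcoord x.1 = x.1 0 0 ^+ 2 + x.1 1 0 ^+ 2.
  have -> : wcoord x.1 * zcoord x.1 = x.1 0 0 ^+ 2 - ('i * 'i) * x.1 1 0 ^+ 2.
    by rewrite /wcoord /zcoord; ring.
  by rewrite mulii mulN1r opprK.
rewrite /W /disc /= !expr1 e -u0_wz -u1_wz !mulf_eq0 !negb_or two_neq0 i_neq0 /=.
by split=> [[? -> -> ->] //|[? /andP[/andP[-> ->] ->]]].
Qed.

(** That [k] is odd matters because [w = - z] has to imply
    [w ^+ k = - z ^+ k]: thus the conditions on [sk x] contain those on [x]. *)
Lemma dom_skP k p0 p1 (hk : odd k) (hp : is_p01 k p0 p1) (x : ambient R) :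
  dom_sk p0 p1 x <-> csphere x.2 /\ disc k (wcoord x.1) (zcoord x.1) != 0.
Proof.
have k0 : (0 < k)%N by case: (k) hk.
rewrite /dom_sk /Wk /= !W_wz /= (wcoord_sk hp) (zcoord_sk hp) /disc !expr1.
set w := wcoord _; set z := zcoord _.
rewrite !mulf_eq0 !negb_or !expf_eq0 k0 /=; split.
  by move=> [_ [? /andP[/andP[/andP[-> ->] ->] ->]]].
move=> [sx /andP[/andP[/andP[w0 z0] wzp] wzm]]; split; last first.
  by rewrite w0 z0 wzp wzm.
have em : 'i * (2 * (x.1 1 0 * eval2 p1 (x.1 0 0) (x.1 1 0 ^+ 2))) = w ^+ k - z ^+ k.
  rewrite -(wcoord_sk hp) -(zcoord_sk hp) -u1_wz /= mxE /=; ring.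
split.
  split => //; rewrite w0 z0 /=; apply/andP; split.
    apply: contraNneq wzp => /eqP; rewrite addr_eq0 => /eqP ->.
    by rewrite exprNn -signr_odd hk expr1 mulN1r addNr.
  by apply: contraNneq wzm => /eqP; rewrite subr_eq0 => /eqP ->; rewrite subrr.
by apply: contraNneq wzm => e0; rewrite -em e0 !mulr0.
Qed.

Lemma csphere3 (s : 'cV[C]_3) :
  csphere s = (s 0 0 ^+ 2 + s 1 0 ^+ 2 + s 2 0 ^+ 2 = 1).
Proof.
rewrite /csphere /= !big_ord_recl big_ord0 addr0 addrA.
by congr (_ ^+ 2 + _ ^+ 2 + _ ^+ 2 = _); congr (s _ _); apply: val_inj.
Qed.

Definition dot3 (s t : 'cV[C]_3) : C :=
  s 0 0 * t 0 0 + s 1 0 * t 1 0 + s 2 0 * t 2 0.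

Section Links.
Variables (k : nat) (p0 p1 : {poly {poly R}}).
Hypotheses (hk : odd k) (hp : is_p01 k p0 p1).
Let D := dom_sk p0 p1.

(** A line joining two points of the plane outside the curve [disc = 0] meets
    this curve finitely often. *)
Lemma linked_plane (u v : 'cV[C]_2) (s : 'cV[C]_3) :
  D (u, s) -> D (v, s) -> linked R D (u, s) (v, s).
Proof.
move=> Du Dv.
pose line a b : {poly C} := (1 - 'X) * a%:P + 'X * b%:P.
pose w := line (wcoord u) (wcoord v); pose z := line (zcoord u) (zcoord v).
pose P := w * z * (w ^+ k + z ^+ k) * (w ^+ k - z ^+ k).
pose gam (t : C) : ambient R := ((1 - t) *: u + t *: v, s).
have eP t : P.[t] = disc k (wcoord (gam t).1) (zcoord (gam t).1).
  rewrite /P /disc /gam /= wcoordD !wcoordZ zcoordD !zcoordZ.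
  by rewrite /w /z /line !hornerE.
have g0 : gam 0 = (u, s) by rewrite /gam subr0 scale1r scale0r addr0.
have g1 : gam 1 = (v, s) by rewrite /gam subrr scale1r scale0r add0r.
have [su Pu] := (dom_skP hk hp _).1 Du.
have [_ Pv] := (dom_skP hk hp _).1 Dv.
rewrite -g0 -g1; apply: (@linked_rational _ _ _ _ P).
- by rewrite eP g0; exact: Pu.
- by rewrite eP g1; exact: Pv.
move=> t Pt; split; first by apply/(dom_skP hk hp); rewrite -eP.
have c1 : {for t, continuous (fun x : C => 1 - x)}.
  exact: (@cvgB C C C (nbhs t) (nbhs_filter t) _ _ _ _ (cvg_cst _) cvg_id).
have c2 : (fun x : C => (1 - x) *: u + x *: v) @ t --> (1 - t) *: u + t *: v.
  exact: (@linear_comb_continuous R 1 C (fun x => 1 - x) id u v t c1 cvg_id).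
exact: (cvg_pair c2 (cvg_cst s)).
Qed.

(** Reflecting [s] in the line spanned by [d = s + x *: t] gives the curve
    [(2 * (s . d) / (d . d)) *: d - s], which lies on the conic cut out of the
    sphere by the span of [s] and [t].  It is [s] at [x = 0] and [t] at
    [x = 1], where [d . d] equals [2 * (1 + s . t)]. *)
Lemma linked_sphere (u : 'cV[C]_2) (s t : 'cV[C]_3) :
  D (u, s) -> D (u, t) -> 1 + dot3 s t != 0 -> linked R D (u, s) (u, t).
Proof.
move=> Ds Dt; set c := dot3 s t => c0.
have [ss Pu] := (dom_skP hk hp _).1 Ds.
have [st _] := (dom_skP hk hp _).1 Dt.
pose P : {poly C} := 1 + (2 * c)%:P * 'X + 'X ^+ 2.
have eP x : P.[x] = 1 + 2 * c * x + x ^+ 2 by rewrite /P !hornerE.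
pose al (x : C) : C := 2 * (1 + x * c) / P.[x].
pose gam (x : C) : ambient R := (u, (al x - 1) *: s + (al x * x) *: t).
have P0 : P.[0] != 0 by rewrite eP mulr0 expr0n !addr0 oner_neq0.
have eP1 : P.[1] = 2 * (1 + c) by rewrite eP; ring.
have P1 : P.[1] != 0 by rewrite eP1 mulf_neq0 // two_neq0.
have g0 : gam 0 = (u, s).
  rewrite /gam /al eP !(mul0r, mulr0) expr0n !addr0 divr1 mulr1 scale0r addr0.
  by rewrite (_ : 2 - 1 = 1) ?scale1r //; ring.
have g1 : gam 1 = (u, t).
  by rewrite /gam /al eP1 mul1r divff ?subrr ?scale0r ?add0r ?mulr1 ?scale1r // -eP1.
rewrite -g0 -g1; apply: (@linked_rational _ _ _ _ P) => // x Px; split.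
  apply/(dom_skP hk hp); split => //=; rewrite csphere3 !mxE.
  have aP : al x * P.[x] = 2 * (1 + x * c) by rewrite /al divfK.
  move: ss st; rewrite /= !csphere3 => ss st.
  (* The norm of the curve is 1 because [al x * (d . d) = 2 * (s . d)]. *)
  transitivity (al x * (al x * P.[x] - 2 * (1 + x * c)) + 1); last first.
    by rewrite aP subrr mulr0 add0r.
  transitivity ((al x - 1) ^+ 2 * (s 0 0 ^+ 2 + s 1 0 ^+ 2 + s 2 0 ^+ 2)
     + 2 * (al x - 1) * (al x * x) * c
     + (al x * x) ^+ 2 * (t 0 0 ^+ 2 + t 1 0 ^+ 2 + t 2 0 ^+ 2)).
    by rewrite /c /dot3; ring.
  by rewrite ss st eP; ring.
have crat (Q : {poly C}) : {for x, continuous (fun y : C => Q.[y] / P.[y])}.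
  have cQ : (horner Q) @ x --> Q.[x] := @horner_continuous C Q x.
  have cP : (horner P) @ x --> P.[x] := @horner_continuous C P x.
  have cV : (fun y : C => (P.[y])^-1) @ x --> (P.[x])^-1.
    exact: (@cvgV C C (nbhs x) (nbhs_filter x) _ _ Px cP).
  exact: (cvgM cQ cV).
pose A : {poly C} := 2%:P * (1 + 'X * c%:P).
have c1 : {for x, continuous (fun y : C => al y - 1)}.
  have h : (fun y : C => A.[y] / P.[y]) @ x --> A.[x] / P.[x] by exact: crat.
  rewrite (_ : (fun y => al y - 1) = (fun y => A.[y] / P.[y] - 1)); last first.
    by apply/funext => y; rewrite /al /A !hornerE.
  exact: (@cvgB C C C (nbhs x) (nbhs_filter x) _ _ _ _ h (cvg_cst _)).
have c2 : {for x, continuous (fun y : C => al y * y)}.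
  have h : (fun y : C => (A * 'X).[y] / P.[y]) @ x --> (A * 'X).[x] / P.[x].
    exact: crat.
  rewrite (_ : (fun y => al y * y) = (fun y => (A * 'X).[y] / P.[y])) //.
  by apply/funext => y; rewrite /al /A !hornerE mulrAC.
have c3 : (fun y => (al y - 1) *: s + (al y * y) *: t) @ x -->
    (al x - 1) *: s + (al x * x) *: t.
  exact: (@linear_comb_continuous R 2 C _ _ s t x c1 c2).
exact: (cvg_pair (cvg_cst u) c3).
Qed.

End Links.
End Isotropic.

(** * Connectedness of the domain *)

Section Domain.
Variable R : realType.
Local Notation C := (Cplx R).
Variables (k : nat) (p0 p1 : {poly {poly R}}).
Hypotheses (hk : odd k) (hp : is_p01 k p0 p1).
Local Notation D := (dom_sk p0 p1).
Local Notation X := (set_type D).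

Let k0 : (0 < k)%N. Proof. by case: (k) hk. Qed.

Definition inD (y : ambient R) (Dy : D y) : X :=
  exist (fun y => y \in D) y (mem_set Dy).

Lemma set_val_inD y (Dy : D y) : set_val (inD Dy) = y.
Proof. by rewrite set_valE. Qed.

(** This is the connectedness of the domain, in the form in which it is used.
    Every [(u, s)] is linked to [(u, e1)]: directly unless [s . e1 = -1], and
    else through [e2] or [- e2], one of which has scalar product with [s]
    different from [-1]. *)
Lemma dom_constant (g : X -> C) : continuous g -> (forall x, g x ^+ k = 1) ->
  forall x y, g x = g y.
Proof.
move=> cg gk.
have lg := linked_const k0 cg gk.
pose e1 : 'cV[C]_3 := delta_mx 0 0.
pose e2 a : 'cV[C]_3 := a *: delta_mx 1 0.
have ce1 : csphere e1 by rewrite csphere3 !mxE /=; ring.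
have ce2 a : a ^+ 2 = 1 -> csphere (e2 a).
  by rewrite csphere3 !mxE /= => a2; rewrite !mulr0 mulr1 a2; ring.
have chg u s t : D (u, s) -> csphere t -> D (u, t).
  by move=> /(dom_skP hk hp)[_ P] st; apply/(dom_skP hk hp).
have spole u s (xs : X) (xe : X) : set_val xs = (u, s) -> set_val xe = (u, e1) ->
    g xs = g xe.
  move=> es ee.
  have Ds : D (u, s) by rewrite -es; apply: set_mem (valP xs).
  have De : D (u, e1) by rewrite -ee; apply: set_mem (valP xe).
  have [s0|s0] := eqVneq (1 + s 0 0) 0; last first.
    apply: lg; rewrite es ee; apply: (linked_sphere hk hp Ds De).
    by rewrite /dot3 !mxE /= mulr1 !mulr0 !addr0.
  have [a [a2 as1]] : exists a, a ^+ 2 = 1 /\ 1 + a * s 1 0 != 0.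
    have [s1|s1] := eqVneq (1 + s 1 0) 0.
      exists (-1); split; first by rewrite sqrrN expr1n.
      rewrite mulN1r (_ : s 1 0 = -1) ?opprK ?two_neq0 //.
      by apply/eqP; rewrite -addr_eq0 addrC s1.
    by exists 1; rewrite expr1n mul1r.
  have Da : D (u, e2 a) by apply: chg Ds (ce2 _ a2).
  pose xa : X := inD Da.
  have exa : set_val xa = (u, e2 a) by exact: set_val_inD.
  transitivity (g xa); apply: lg; rewrite ?es ?ee exa.
    apply: (linked_sphere hk hp Ds Da).
    by rewrite /dot3 !mxE /= !(mulr0, mulr1) add0r addr0 mulrC.
  apply: (linked_sphere hk hp Da De).
  by rewrite /dot3 !mxE /= !(mulr0, mul0r, addr0) oner_neq0.
move=> x y.
case ex : (set_val x) => [u s]; case ey : (set_val y) => [v t].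
have Dx : D (u, s) by rewrite -ex; apply: set_mem (valP x).
have Dy : D (v, t) by rewrite -ey; apply: set_mem (valP y).
have Du := chg _ _ _ Dx ce1; have Dv := chg _ _ _ Dy ce1.
pose xu : X := inD Du; pose xv : X := inD Dv.
have exu : set_val xu = (u, e1) by exact: set_val_inD.
have exv : set_val xv = (v, e1) by exact: set_val_inD.
rewrite (spole _ _ _ _ ex exu) (spole _ _ _ _ ey exv).
by apply: lg; rewrite exu exv; apply: (linked_plane hk hp).
Qed.

Lemma valD (x : X) : D (set_val x). Proof. exact: set_mem (valP x). Qed.

Lemma wz_neq0 (x : X) :
  wcoord (set_val x).1 != 0 /\ zcoord (set_val x).1 != 0.
Proof.
have [_] := (dom_skP hk hp _).1 (valD x).
by rewrite /disc !mulf_eq0 !negb_or => /andP[/andP[/andP[-> ->]]].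
Qed.

Lemma dom_base_point : exists x : X,
  wcoord (set_val x).1 != 0 /\ zcoord (set_val x).1 != 0.
Proof.
(* The point with [w = 2] and [z = 1]. *)
pose u : 'cV[C]_2 := \col_i (if i == 0 then 3 / 2 else 1 / (2 * 'i)).
have i0 := i_neq0 R.
have wu : wcoord u = 2 by rewrite /wcoord !mxE /=; field.
have zu : zcoord u = 1 by rewrite /zcoord !mxE /=; field.
have Du : D (u, delta_mx 0 0).
  apply/(dom_skP hk hp); split; first by rewrite csphere3 !mxE /=; ring.
  rewrite /= wu zu /disc expr1n mulr1 !mulf_neq0 ?two_neq0 //.
  by rewrite subr_eq0 -natrX (eqr_nat _ _ 1) -(expn0 2) eqn_exp2l // -lt0n.
by exists (inD Du); exact: wz_neq0.
Qed.

End Domain.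

(** * Deck transformations *)

Section DeckTransformations.
Variable R : realType.
Local Notation C := (Cplx R).

(** The matrix that is diagonal with eigenvalues [a] and [b] in the coordinates
    [wcoord] and [zcoord]. *)
Definition scale_mx (a b : C) : 'M[C]_2 :=
  \matrix_(i < 2, j < 2)
    if i == j then (a + b) / 2
    else if i == 0 then 'i * (a - b) / 2 else - ('i * (a - b) / 2).

Lemma scale_mx_col (a b : C) u i : (scale_mx a b *m u) i 0 =
  scale_mx a b i 0 * u 0 0 + scale_mx a b i 1 * u (1 : 'I_2) (0 : 'I_1).
Proof.
rewrite mxE !big_ord_recl big_ord0 addr0.
by congr (_ + scale_mx a b i _ * u _ _); apply: val_inj.
Qed.

Lemma wcoord_scale a b u : wcoord (scale_mx a b *m u) = a * wcoord u.
Proof.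
rewrite /wcoord !scale_mx_col !mxE /=.
set x := u 0 0; set y := u 1 0.
transitivity ((a + b) / 2 * x + ('i * (a - b) / 2) * y
  + ('i * ((a + b) / 2) * y - ('i * 'i) * (a - b) / 2 * x)).
  by field.
by rewrite mulii; field.
Qed.

Lemma zcoord_scale a b u : zcoord (scale_mx a b *m u) = b * zcoord u.
Proof.
rewrite /zcoord !scale_mx_col !mxE /=.
set x := u 0 0; set y := u 1 0.
transitivity ((a + b) / 2 * x + ('i * (a - b) / 2) * y
  - ('i * ((a + b) / 2) * y - ('i * 'i) * (a - b) / 2 * x)).
  by field.
by rewrite mulii; field.
Qed.

Lemma rot_scale_mx k (xi eta : C) : (0 < k)%N -> eta ^+ k = 1 ->
  xi *: rot_mx eta = scale_mx (xi * eta) (xi * eta^-1).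
Proof.
move=> k0 ek; have ec := unity_conj k0 ek.
have eRe : 'Re eta = (eta + eta^-1) / 2 by rewrite ReE ec.
have eIm : 'Im eta = 'i * (eta^-1 - eta) / 2 by rewrite ImE ec.
apply/matrixP => i j; rewrite !mxE eRe eIm.
have [//|] := eqVneq i j; first by move=> _; ring.
by move=> _; case: (i == 0); ring.
Qed.

Lemma mx_act_continuous (M : 'M[C]_2) :
  continuous (mx_act M : ambient R -> ambient R).
Proof.
move=> x.
have cf i : {for x, continuous (fun y : ambient R => y.1 i 0)}.
  apply: (@continuous_comp _ _ _ (fst : ambient R -> 'cV[C]_2) (fun u => u i 0)).
    exact: cvg_fst.
  exact: coord_continuous.
have h : (fun y : ambient R => y.1 0 0 *: col 0 M + y.1 1 0 *: col 1 M) @ x -->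
    x.1 0 0 *: col 0 M + x.1 1 0 *: col 1 M.
  exact: (@linear_comb_continuous R 1 (ambient R) _ _ (col 0 M) (col 1 M) x
    (cf 0) (cf 1)).
rewrite (_ : mx_act M = fun y => (y.1 0 0 *: col 0 M + y.1 1 0 *: col 1 M, y.2)).
  exact: (cvg_pair h cvg_snd).
apply/funext => y; rewrite /mx_act; congr (_, _).
apply/matrixP => i j; rewrite ord1 !mxE !big_ord_recl big_ord0 addr0 mulrC.
rewrite [X in _ + X]mulrC.
by congr (_ + y.1 _ _ * M _ _); apply: val_inj.
Qed.

Section Fixed.
Variables (k : nat) (p0 p1 : {poly {poly R}}).
Hypotheses (hk : odd k) (hp : is_p01 k p0 p1).
Local Notation D := (dom_sk p0 p1).
Local Notation X := (set_type D).

Let k0 : (0 < k)%N. Proof. by case: (k) hk. Qed.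

(** Applied to [l = wcoord] and [l = zcoord]: the quotient
    [l (f x) / l x] is a continuous [k]-th root of unity on the domain. *)
Lemma deck_ratio (l : 'cV[C]_2 -> C) (f : X -> X) : continuous l ->
  (forall x : X, l (set_val x).1 != 0) ->
  (forall x : ambient R, l (sk p0 p1 x).1 = l x.1 ^+ k) ->
  is_deck (sk_cov p0 p1) f ->
  exists2 a : C, a ^+ k = 1 &
    forall x, l (set_val (f x)).1 = a * l (set_val x).1.
Proof.
move=> cl l0 lk [[f' [_ _ cf _]] pf].
pose g (x : X) : C := l (set_val (f x)).1 / l (set_val x).1.
have gk x : g x ^+ k = 1.
  have /(congr1 set_val) := congr1 (fun F => F x) pf.
  rewrite !set_valE /= => /(congr1 (fun y => l y.1)); rewrite !lk /g => e.
  by rewrite expr_div_n -!lk !set_valE !lk e divff // expf_neq0 // -set_valE.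
have cval : continuous (fun x : X => l (set_val x).1).
  move=> x; apply: (@continuous_comp _ _ _ (fun x : X => (set_val x).1) l);
    last exact: cl.
  apply: (@continuous_comp _ _ _ (set_val : X -> ambient R) fst); last exact: cvg_fst.
  exact: initial_continuous.
have cg : continuous g.
  move=> x; have h1 : (fun x => l (set_val (f x)).1) @ x --> l (set_val (f x)).1.
    apply: (@continuous_comp _ _ _ f (fun x => l (set_val x).1)); first exact: cf.
    exact: cval.
  have h2 : (fun x : X => (l (set_val x).1)^-1) @ x --> (l (set_val x).1)^-1.
    exact: (@cvgV C X (nbhs x) (nbhs_filter x) _ _ (l0 x) (cval x)).
  exact: (cvgM h1 h2).
have gc := dom_constant hk hp cg gk.
have [x1 _] := dom_base_point hk hp.
by exists (g x1) => // x; rewrite (gc x1 x) /g divfK.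
Qed.

Lemma mx_act_dom a b (x : X) : a ^+ k = 1 -> b ^+ k = 1 ->
  D (mx_act (scale_mx a b) (set_val x)).
Proof.
move=> ak bk; apply/(dom_skP hk hp).
have [sx Px] := (dom_skP hk hp _).1 (valD x).
split => //=; move: Px; rewrite wcoord_scale zcoord_scale /disc !exprMn ak bk !mul1r.
by rewrite !mulf_eq0 !negb_or !(unity_neq0 k0 ak) !(unity_neq0 k0 bk).
Qed.

Lemma deck_is_scale (f : Deck (sk_cov p0 p1)) : exists a b,
  [/\ a ^+ k = 1, b ^+ k = 1 &
   forall x, set_val (deck_fun f x) = mx_act (scale_mx a b) (set_val x)].
Proof.
have df : is_deck (sk_cov p0 p1) (deck_fun f) by exact: svalP.
have [a ak wa] := deck_ratio (@wcoord_continuous R)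
  (fun x => (wz_neq0 hk hp x).1) (wcoord_sk hp) df.
have [b bk zb] := deck_ratio (@zcoord_continuous R)
  (fun x => (wz_neq0 hk hp x).2) (zcoord_sk hp) df.
exists a, b; split => // x.
rewrite [LHS]surjective_pairing /mx_act; congr (_, _).
  by apply: wz_inj; rewrite ?wcoord_scale ?zcoord_scale.
have [_ /(congr1 (fun F => F x))] := df.
by move=> /(congr1 set_val); rewrite !set_valE /= => /(congr1 snd).
Qed.

(** The inverse of [scale_mx a b] is [scale_mx a^-1 b^-1], which has the same
    form; this gives the inverse homeomorphism. *)
Lemma scale_is_deck a b : a ^+ k = 1 -> b ^+ k = 1 ->
  exists f : Deck (sk_cov p0 p1),
   forall x, set_val (deck_fun f x) = mx_act (scale_mx a b) (set_val x).
Proof.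
have mk c d (ck : c ^+ k = 1) (dk : d ^+ k = 1) : exists2 f : X -> X, continuous f &
    forall x, set_val (f x) = mx_act (scale_mx c d) (set_val x).
  exists (fun x => inD (mx_act_dom x ck dk)) => [|x]; last exact: set_val_inD.
  apply: continuous_comp_initial => x.
  apply: (@continuous_comp _ _ _ (set_val : X -> ambient R) (mx_act (scale_mx c d))).
    exact: initial_continuous.
  exact: mx_act_continuous.
move=> ak bk.
have [f cf fE] := mk _ _ ak bk.
have [g cg gE] : exists2 g : X -> X, continuous g & forall x,
    set_val (g x) = mx_act (scale_mx a^-1 b^-1) (set_val x).
  by apply: mk; rewrite exprVn ?ak ?bk invr1.
have ext (x y : X) : wcoord (set_val x).1 = wcoord (set_val y).1 ->
    zcoord (set_val x).1 = zcoord (set_val y).1 ->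
    (set_val x).2 = (set_val y).2 -> x = y.
  move=> hw hz hs; apply: val_inj; rewrite -!set_valE.
  by rewrite [LHS]surjective_pairing [RHS]surjective_pairing hs (wz_inj hw hz).
have fg : cancel f g.
  move=> x; apply: ext; rewrite gE /= ?wcoord_scale ?zcoord_scale fE //=
    ?wcoord_scale ?zcoord_scale mulKf //; exact: unity_neq0 k0 _.
have gf : cancel g f.
  move=> x; apply: ext; rewrite fE /= ?wcoord_scale ?zcoord_scale gE //=
    ?wcoord_scale ?zcoord_scale mulVKf //; exact: unity_neq0 k0 _.
have pf : sk_cov p0 p1 \o f = sk_cov p0 p1.
  apply/funext => x; apply: val_inj => /=.
  rewrite [LHS]surjective_pairing [RHS]surjective_pairing; congr (_, _).
    by apply: wz_inj; rewrite ?(wcoord_sk hp) ?(zcoord_sk hp) fE /=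
      ?wcoord_scale ?zcoord_scale exprMn ?ak ?bk mul1r.
  by rewrite /= fE.
have df : is_deck (sk_cov p0 p1) f by split => //; exists g.
by exists (exist _ f df).
Qed.

Lemma deck_eq (f g : Deck (sk_cov p0 p1)) :
  (forall x, set_val (deck_fun f x) = set_val (deck_fun g x)) -> f = g.
Proof.
move=> fg; apply: deck_fun_inj; apply/funext => x; apply: val_inj.
exact: fg.
Qed.

(** A primitive [k]-th root of unity [ze] makes [(i, j) |-> scale_mx (ze ^+ i)
    (ze ^+ j)] an isomorphism; it is injective since [w] and [z] do not vanish
    at a point of the domain. *)
Lemma deck_isomorphic : isomorphic (Deck (sk_cov p0 p1)) (Zmod k * Zmod k)%type.
Proof.
have [ze hze] := prim_root_exists R k0.
have zek n : (ze ^+ n) ^+ k = 1 by rewrite exprAC (prim_expr_order hze) expr1n.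
have [F FE] : exists F : Zmod k * Zmod k -> Deck (sk_cov p0 p1), forall ij x,
    set_val (deck_fun (F ij) x) =
    mx_act (scale_mx (ze ^+ ij.1) (ze ^+ ij.2)) (set_val x).
  exists (fun ij : Zmod k * Zmod k =>
    sval (cid (scale_is_deck (zek ij.1) (zek ij.2)))) => ij x.
  by case: cid.
have Finj : injective F.
  move=> ij ij' eF; have [x [w0 z0]] := dom_base_point hk hp.
  have := FE ij x; rewrite eF FE => /(congr1 fst) /= e.
  have lt_k (i : Zmod k) : (i < k)%N by rewrite -[ltnRHS](prednK k0).
  have inj (i j : Zmod k) : ze ^+ i = ze ^+ j -> i = j.
    move=> /eqP; rewrite (eq_prim_root_expr hze) !modn_small // => /eqP.
    exact: val_inj.
  rewrite [LHS]surjective_pairing [RHS]surjective_pairing.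
  move: (congr1 (@wcoord R) e) (congr1 (@zcoord R) e).
  rewrite !wcoord_scale !zcoord_scale => /(mulIf w0)/inj <- /(mulIf z0)/inj <-.
  by [].
have Fsurj f : exists ij, F ij = f.
  have [a [b [ak bk fE]]] := deck_is_scale f.
  have [i ai] := prim_rootP hze ak; have [j bj] := prim_rootP hze bk.
  have kk : k = k.-1.+1 by rewrite prednK.
  exists (cast_ord kk i, cast_ord kk j); apply: deck_eq => x.
  by rewrite FE fE /= ai bj.
have Fmul : {morph F : ij ij' / (ij * ij')%g}.
  move=> ij ij'; apply: deck_eq => x.
  have zeD (i j : Zmod k) : ze ^+ (i * j)%g = ze ^+ i * ze ^+ j.
    rewrite -exprD -[RHS](prim_expr_mod hze); congr (_ ^+ (_ %% _)).
    exact: prednK.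
  rewrite FE [deck_fun _ x]/= -/(deck_fun (F ij) _) FE FE /mx_act /= !zeD; congr (_, _).
  by apply: wz_inj; rewrite ?wcoord_scale ?zcoord_scale mulrA.
pose G f := sval (cid (Fsurj f)).
have FG : cancel G F by move=> f; rewrite /G; case: cid.
have GF : cancel F G by move=> ij; apply: Finj; rewrite FG.
exists G; split; first by exists F.
by move=> f g; apply: Finj; rewrite Fmul !FG.
Qed.

Lemma deck_set :
  [set (fun x => set_val (deck_fun a x)) | a in [set: Deck (sk_cov p0 p1)]] =
  [set (fun x : set_type (dom_sk p0 p1) =>
          mx_act (xi *: rot_mx eta) (set_val x))
     | xi in unity_roots R k & eta in unity_roots R k].
Proof.
apply/seteqP; split => [_ [f _ <-]|_ [xi xik [eta etak <-]]].
  have [a [b [ak bk fE]]] := deck_is_scale f.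
  have [xi [eta [xik etak ea eb]]] := odd_unity_factor hk ak bk.
  exists xi => //; exists eta => //; apply/funext => x.
  by rewrite (rot_scale_mx _ k0 etak) ea eb fE.
have [||f fE] := @scale_is_deck (xi * eta) (xi * eta^-1).
- by rewrite exprMn xik etak mulr1.
- by rewrite exprMn exprVn xik etak invr1 mulr1.
by exists f => //; apply/funext => x; rewrite fE (rot_scale_mx _ k0 etak).
Qed.

End Fixed.
End DeckTransformations.

Theorem proposition6p2 (R : realType) (k : nat) (p0 p1 : {poly {poly R}})
    (hk : odd k) (hp : is_p01 k p0 p1) :
  [set (fun x => set_val (deck_fun a x)) | a in [set: Deck (sk_cov p0 p1)]] =
  [set (fun x : set_type (dom_sk p0 p1) =>
          mx_act (xi *: rot_mx eta) (set_val x))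
     | xi in unity_roots R k & eta in unity_roots R k]
  /\ isomorphic (Deck (sk_cov p0 p1)) (Zmod k * Zmod k)%type.
Proof. by split; [exact: deck_set | exact: deck_isomorphic]. Qed.
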